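(* Let $A$ be a complex Banach space. Every $\mathbf a\in\ell^1_b(A)$ induces a bounded linear operator $\Lambda_{\mathbf a}:c_0\to A$, defined by the norm-convergent series $\Lambda_{\mathbf a}(\beta)=\sum_{i=1}^\infty\beta_i a_i$ for $\beta=(\beta_i)\in c_0$, with $\|\Lambda_{\mathbf a}\|=|||\mathbf a|||_1$. Conversely, if $\Lambda:c_0\to A$ is a bounded linear operator, then $\Lambda=\Lambda_{\mathbf a}$ for some $\mathbf a\in\ell^1_b(A)$. Moreover, $\Lambda=\Lambda_{\mathbf a}$ is compact if and only if $\mathbf a\in\ell^1_c(A)$.
   Context: All vector spaces are over $\mathbb C$. $A^*$ is the topological dual of $A$ and $A^*_1=\{\phi\in A^*:\|\phi\|\le 1\}$. For a sequence $\mathbf a=(a_1,a_2,\dots)$ in $A$ and $\phi\in A^*$, put $\phi(\mathbf a)=(\phi(a_1),\phi(a_2),\dots)$. $\ell^1_b(A)$ (resp. $\ell^1_c(A)$) is the set of all sequences $\mathbf a$ in $A$ such that $\{\phi(\mathbf a):\phi\in A^*_1\}$ is contained in $\ell^1$ and is a bounded (resp. totally bounded) subset of $\ell^1$. For $\mathbf a\in\ell^1_b(A)$, $|||\mathbf a|||_1=\sup\{\|\phi(\mathbf a)\|_1:\phi\in A^*_1\}$. $c_0$ is the space of complex sequences converging to $0$, with the sup norm. *)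

(* Defs.v *)
From HB Require Import structures.
From mathcomp Require Import all_boot all_order all_algebra.
From mathcomp Require Import all_classical all_reals all_analysis.
From mathcomp Require Export complex.

Set Implicit Arguments.
Unset Strict Implicit.
Unset Printing Implicit Defensive.

Import Order.TTheory GRing.Theory Num.Theory.
Import numFieldNormedType.Exports.

Local Open Scope classical_set_scope.
Local Open Scope ring_scope.
Local Open Scope complex_scope.

(* R[i] packaged as a field, so that it carries the normed space structure
   that [numFieldNormedType] provides. *)
Definition C (R : realType) : numClosedFieldType := R[i].

(* The norm of a normed module over R[i] takes its (real, nonnegative) values
   in R[i]; [rnorm] is the same norm with values in R. *)
Definition rnorm (R : realType) (V : normedModType (C R)) (x : V) : R :=
  complex.Re `|x|.

Section rnorm_theory.
Context {R : realType} {V : normedModType (C R)}.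
Implicit Types x y : V.

Lemma rnormE x : (rnorm x)%:C = `|x|.
Proof. by rewrite /rnorm RRe_real. Qed.

Lemma rnorm_ge0 x : 0 <= rnorm x.
Proof. by rewrite -ler0c rnormE. Qed.

Lemma rnorm0 : rnorm (0 : V) = 0.
Proof. by rewrite /rnorm normr0. Qed.

Lemma rnorm0_eq0 x : rnorm x = 0 -> x = 0.
Proof. by move=> x0; apply/normr0_eq0; rewrite -rnormE x0. Qed.

Lemma rnormD x y : rnorm (x + y) <= rnorm x + rnorm y.
Proof. by rewrite -lecR rmorphD/= !rnormE ler_normD. Qed.

Lemma rnormZ (k : C R) x : rnorm (k *: x) = rnorm k * rnorm x.
Proof. by apply: (@complexI R); rewrite rmorphM/= !rnormE normrZ. Qed.

End rnorm_theory.

Section c0.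
Context {R : realType}.

Definition in_c0 : {pred nat -> C R} :=
  [pred b : nat -> C R | `[< b @ \oo --> (0 : C R) >]].

Record c0 := C0 { c0_seq :> nat -> C R; _ : in_c0 c0_seq }.

HB.instance Definition _ := [isSub for c0_seq].
HB.instance Definition _ := [Choice of c0 by <:].

Lemma in_c0_submod_closed : submod_closed in_c0.
Proof.
split; first by apply/asboolP; exact: cvg_cst.
move=> k x y /asboolP cx /asboolP cy; apply/asboolP.
rewrite -[X in _ --> X]addr0; apply: cvgD => //.
by rewrite -[X in _ --> X](mulr0 k); exact: cvgMr.
Qed.

HB.instance Definition _ :=
  GRing.isSubmodClosed.Build _ _ in_c0 in_c0_submod_closed.
HB.instance Definition _ := [SubChoice_isSubLmodule of c0 by <:].

Definition c0_rnorm (b : c0) : R := sup (range (fun i => rnorm (b i))).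

Lemma c0_has_sup (b : c0) : has_sup (range (fun i => rnorm (b i))).
Proof.
split; first by exists (rnorm (b 0%N)), 0%N.
case: b => b /= /asboolP cb.
have /cvg_seq_bounded : cvgn b by apply/cvg_ex; exists 0.
move=> /pinfty_ex_gt0[M _ Mb]; exists (complex.Re M) => _ [i _ <-].
by have := Mb i Logic.I; rewrite /= lecE => /andP[].
Qed.

Lemma c0_rnorm_ub (b : c0) i : rnorm (b i) <= c0_rnorm b.
Proof. by apply: (ub_le_sup (c0_has_sup b).2); exists i. Qed.

Lemma c0_rnorm_le (b : c0) (M : R) :
  (forall i, rnorm (b i) <= M) -> c0_rnorm b <= M.
Proof. by move=> bM; apply: (ge_sup (c0_has_sup b).1) => _ [i _ <-]. Qed.

Let c0_norm (b : c0) : C R := (c0_rnorm b)%:C.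

Let c0_normD x y : c0_norm (x + y) <= c0_norm x + c0_norm y.
Proof.
rewrite -rmorphD/= lecR; apply: c0_rnorm_le => i.
by rewrite (le_trans (rnormD _ _))// lerD// c0_rnorm_ub.
Qed.

Let c0_normZ (k : C R) x : c0_norm (k *: x) = `|k| * c0_norm x.
Proof.
have k0 : 0 <= rnorm k := rnorm_ge0 k.
rewrite /c0_norm -[`|k|]rnormE -rmorphM/=; congr (_ %:C); apply/eqP; rewrite eq_le.
apply/andP; split.
  by apply: c0_rnorm_le => i; rewrite rnormZ ler_wpM2l// c0_rnorm_ub.
have [->|kn0] := eqVneq (rnorm k) 0.
  by rewrite mul0r (le_trans (rnorm_ge0 _) (c0_rnorm_ub _ 0%N)).
have {kn0}k0 : 0 < rnorm k by rewrite lt_def kn0.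
rewrite -ler_pdivlMl//; apply: c0_rnorm_le => i.
by rewrite ler_pdivlMl// -rnormZ; exact: (c0_rnorm_ub (k *: x)).
Qed.

Let c0_norm0_eq0 x : c0_norm x = 0 -> x = 0.
Proof.
move=> /(@complexI R _ 0) x0; apply/val_inj/funext => i.
apply: (@rnorm0_eq0 R (C R)); apply/eqP; rewrite eq_le rnorm_ge0 andbT -[leRHS]x0.
exact: c0_rnorm_ub.
Qed.

HB.instance Definition _ :=
  Lmodule_isNormed.Build (C R) c0 c0_normD c0_normZ c0_norm0_eq0.

End c0.
Arguments c0 R : clear implicits.

Section l1.
Context {R : realType}.

Definition in_l1 : {pred nat -> C R} :=
  [pred x : nat -> C R | `[< cvgn (series (fun i => rnorm (x i))) >]].

Record l1 := L1 { l1_seq :> nat -> C R; _ : in_l1 l1_seq }.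

HB.instance Definition _ := [isSub for l1_seq].
HB.instance Definition _ := [Choice of l1 by <:].

Lemma in_l1_submod_closed : submod_closed in_l1.
Proof.
split.
  apply/asboolP; rewrite (_ : series _ = cst 0); first exact: is_cvg_cst.
  apply/funext => n; rewrite /series/= big1// => i _; exact: rnorm0.
move=> k x y /asboolP cx /asboolP cy; apply/asboolP.
pose nx i : R := rnorm (x i); pose ny i : R := rnorm (y i).
apply: (@series_le_cvg _ _ (rnorm k *: nx + ny)) => [i|i|i|].
- exact: rnorm_ge0.
- by rewrite addr_ge0// ?mulr_ge0// rnorm_ge0.
- by rewrite (le_trans (rnormD _ _))// rnormZ.
- by apply: is_cvg_seriesD => //; exact: is_cvg_seriesZ.
Qed.

HB.instance Definition _ :=
  GRing.isSubmodClosed.Build _ _ in_l1 in_l1_submod_closed.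
HB.instance Definition _ := [SubChoice_isSubLmodule of l1 by <:].

Definition l1_rnorm (x : l1) : R := limn (series (fun i => rnorm (x i))).

Lemma l1_cvg (x : l1) : cvgn (series (fun i => rnorm (x i))).
Proof. by case: x => x /= /asboolP. Qed.

Let l1_norm (x : l1) : C R := (l1_rnorm x)%:C.

Let l1_normD x y : l1_norm (x + y) <= l1_norm x + l1_norm y.
Proof.
rewrite -rmorphD/= lecR /l1_rnorm -lim_seriesD; [|exact: l1_cvg..].
apply: ler_lim; first exact: l1_cvg.
  by apply: is_cvg_seriesD; exact: l1_cvg.
by apply: nearW => n; apply: ler_sum => i _; exact: rnormD.
Qed.

Let l1_normZ (k : C R) x : l1_norm (k *: x) = `|k| * l1_norm x.
Proof.
rewrite /l1_norm -[`|k|]rnormE -rmorphM/=; congr (_ %:C).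
rewrite /l1_rnorm -[RHS](lim_seriesZ (rnorm k) (@l1_cvg x)).
by congr (limn (series _)); apply/funext => i; rewrite rnormZ.
Qed.

Let l1_norm0_eq0 x : l1_norm x = 0 -> x = 0.
Proof.
move=> /(@complexI R _ 0) x0; apply/val_inj/funext => i.
apply: (@rnorm0_eq0 R (C R)); apply/eqP; rewrite eq_le rnorm_ge0 andbT -[leRHS]x0.
apply: (@le_trans _ _ (series (fun i => rnorm (x i)) i.+1)).
  by rewrite /series/= big_nat_recr//= lerDr sumr_ge0// => j _; exact: rnorm_ge0.
apply: nondecreasing_cvgn_le; last exact: l1_cvg.
apply/nondecreasing_seqP => n; rewrite /series/= big_nat_recr//=.
by rewrite lerDl rnorm_ge0.
Qed.

HB.instance Definition _ :=
  Lmodule_isNormed.Build (C R) l1 l1_normD l1_normZ l1_norm0_eq0.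

End l1.
Arguments l1 R : clear implicits.

Lemma rnorm_c0 (R : realType) (b : c0 R) :
  rnorm b = sup (range (fun i => rnorm (b i))).
Proof. by []. Qed.

Lemma rnorm_l1 (R : realType) (x : l1 R) :
  rnorm x = limn (series (fun i => rnorm (x i))).
Proof. by []. Qed.

Definition totally_bounded (K : numFieldType) (V : pseudoMetricType K)
    (S : set V) :=
  forall e : K, 0 < e ->
    exists2 F : set V, finite_set F & S `<=` \bigcup_(y in F) ball y e.

Section operators.
Context {R : realType} {V W : normedModType (C R)}.

(* [sup] of an unbounded set is 0 by convention: [opnorm] is the operator norm
   only of bounded operators, and [norm1] below is meaningful only on [l1b]. *)
Definition opnorm (f : V -> W) : R :=
  sup [set rnorm (f x) | x in [set x | rnorm x <= 1]].

Definition bounded_linear (f : V -> W) :=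
  linear f /\ exists M : R, forall x, rnorm (f x) <= M * rnorm x.

Definition compact_op (f : V -> W) :=
  precompact (f @` [set x | rnorm x <= 1]).

End operators.

Section sequences_in_banach.
Context {R : realType} {A : normedModType (C R)}.

Definition dual_ball : set {linear A -> C R} :=
  [set phi | continuous phi /\ opnorm phi <= 1].

(* The members of { phi(a) : phi in A^*_1 } that lie in l^1; this is the whole
   family exactly when [weakly_l1 a] holds. *)
Definition weak_image (a : nat -> A) : set (l1 R) :=
  [set x | exists2 phi, dual_ball phi & l1_seq x = phi \o a].

Definition weakly_l1 (a : nat -> A) :=
  forall phi, dual_ball phi -> in_l1 (phi \o a).

Definition l1b : set (nat -> A) :=
  [set a | weakly_l1 a /\ bounded_set (weak_image a)].

Definition l1c : set (nat -> A) :=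
  [set a | weakly_l1 a /\ totally_bounded (weak_image a)].

Definition norm1 (a : nat -> A) : R :=
  sup [set rnorm x | x in weak_image a].

Definition Lambda_series (a : nat -> A) (b : c0 R) : nat -> A :=
  series (fun i => b i *: a i).

Definition Lambda (a : nat -> A) (b : c0 R) : A := limn (Lambda_series a b).

End sequences_in_banach.

(* Main.v *)
(* The operator induced by [a] is the preadjoint of [phi |-> phi(a)]: bounding
   [sum_i beta_i a_i] through norming functionals (Hahn-Banach) makes the
   series Cauchy as soon as the sums [sum_i |phi(a_i)|] are uniformly bounded,
   and testing [phi] on truncated sequences of phases recovers those sums from
   the operator.  Conversely [a_i] is the image of the i-th unit sequence,
   finite sequences being dense in [c_0].  Compactness is Schauder's theorem for
   the pairing [(beta, phi) |-> phi(Lambda beta)] between the unit ball of [c_0]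
   and the dual ball: a finite net on one side maps the other side to a bounded
   subset of some C^k, hence yields a finite net there. *)
Require Import Defs.
From HB Require Import structures.
From mathcomp Require Import all_boot all_order all_algebra.
From mathcomp Require Import all_classical all_reals all_analysis.
From mathcomp Require Import complex finmap lra.

Set Implicit Arguments.
Unset Strict Implicit.
Unset Printing Implicit Defensive.

Import Order.TTheory GRing.Theory Num.Theory.
Import numFieldNormedType.Exports.

Local Open Scope classical_set_scope.
Local Open Scope ring_scope.

Local Open Scope complex_scope.

(** * The Hahn-Banach theorem *)

Section sublinear_functionals.
Context {R : realType} {V : lmodType (C R)}.
Implicit Types (p q f g : V -> R) (x y : V) (r s t : R).

Definition sublinear p :=
  (forall x y, p (x + y) <= p x + p y) /\
  (forall r x, 0 <= r -> p (r%:C *: x) = r * p x).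

Lemma sublinear0 p : sublinear p -> p 0 = 0.
Proof. by case=> _ /(_ 0 0 (lexx 0)); rewrite scaler0 mul0r. Qed.

Lemma sublinear_geN p x : sublinear p -> - p (- x) <= p x.
Proof.
by move=> sp; rewrite lerNl -subr_ge0 opprK addrC -(sublinear0 sp) -(subrr x) sp.1.
Qed.

(** The reverse inequality is the assumed one for [r^-1] and [r%:C *: x]. *)
Lemma sublinearW p : (forall x y, p (x + y) <= p x + p y) -> p 0 = 0 ->
  (forall r x, 0 < r -> p (r%:C *: x) <= r * p x) -> sublinear p.
Proof.
move=> pD p0 pZ; split=> // r x; rewrite le_eqVlt => /predU1P[<-|r0].
  by rewrite scale0r mul0r.
apply/eqP; rewrite eq_le pZ//= -ler_pdivlMl//.
have := pZ r^-1 (r%:C *: x); rewrite invr_gt0 => /(_ r0).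
by rewrite scalerA -rmorphM mulVf ?gt_eqF// scale1r.
Qed.

(** For sublinear [p], this is the largest sublinear functional below [p] whose value at [- y] is at
    most [- p y]. *)
Definition tilt p y x := inf [set p (x + t%:C *: y) - t * p y | t in [set t | 0 <= t]].

Section tilt.
Variables (p : V -> R) (y : V).
Hypothesis sp : sublinear p.

Lemma tilt_ge x c :
  (forall t, 0 <= t -> c <= p (x + t%:C *: y) - t * p y) -> c <= tilt p y x.
Proof.
move=> h; apply: lb_le_inf; last by move=> _ [t /h h' <-].
by exists (p (x + 0%:C *: y) - 0 * p y), 0 => //=.
Qed.

Lemma tilt_le x t : 0 <= t -> tilt p y x <= p (x + t%:C *: y) - t * p y.
Proof.
move=> t0; apply: ge_inf; last by exists t.
(* By subadditivity [s * p y <= p (x + s%:C *: y) + p (- x)], so the infimum is taken over a set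
   bounded below. *)
exists (- p (- x)) => _ [s s0 <-].
by rewrite lerBrDr addrC -lerBrDr opprK -(sp.2 _ _ s0)
  (le_trans _ (sp.1 _ _))// addrAC subrr add0r.
Qed.

Lemma tilt_le_self x : tilt p y x <= p x.
Proof. by have := tilt_le x (lexx 0); rewrite scale0r addr0 mul0r subr0. Qed.

Lemma sublinear_tilt : sublinear (tilt p y).
Proof.
apply: sublinearW => [x x'||r x r0].
(* The values at [s] for [x] and at [t] for [x'] together dominate the value at [s + t] for
   [x + x']. *)
- rewrite -lerBlDl; apply: tilt_ge => t t0.
  rewrite lerBlDr -lerBlDl; apply: tilt_ge => s s0; rewrite lerBlDl.
  have := tilt_le (x + x') (addr_ge0 s0 t0).
  have := sp.1 (x + s%:C *: y) (x' + t%:C *: y).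
  rewrite addrACA -scalerDl -rmorphD/=; lra.
- apply/eqP; rewrite eq_le (le_trans (tilt_le_self 0)) ?(sublinear0 sp)//=.
  by apply: tilt_ge => t t0; rewrite add0r sp.2// subrr.
- rewrite -ler_pdivrMl//; apply: tilt_ge => t t0; rewrite ler_pdivrMl//.
  apply: (le_trans (tilt_le _ (mulr_ge0 (ltW r0) t0))).
  by rewrite rmorphM/= -scalerA -scalerDr (sp.2 _ _ (ltW r0)) -mulrA -mulrBr.
Qed.

End tilt.

(** Zorn's lemma for the reversed pointwise order. The infimum of a nonempty chain is finite because
    every member dominates [- p (- x)], and subadditive because, of two members, one lies below the
    other everywhere. *)
Lemma exists_minimal_sublinear p : sublinear p ->
  exists f, [/\ sublinear f, forall x, f x <= p x &
    forall g, sublinear g -> (forall x, g x <= f x) -> forall x, f x <= g x].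
Proof.
move=> sp; pose T := {f | sublinear f /\ forall x, f x <= p x}.
pose leT (f g : T) := `[< forall x, sval g x <= sval f x >].
have pT : sublinear p /\ forall x, p x <= p x by [].
have [||F totF|[f [sf fp]] fmin] := @ZL_preorder T (exist _ p pT) leT.
- by move=> f; apply/asboolP.
- move=> g f h /asboolP gf /asboolP fh; apply/asboolP => x.
  exact: le_trans (fh x) (gf x).
- have [[f0 Ff0]|F0] := pselect (F !=set0); last first.
    by exists (exist _ p pT) => f Ff; case: F0; exists f.
  pose q x := inf [set sval f x | f in F].
  have q_le (f : T) x : F f -> q x <= sval f x.
    move=> Ff; apply: ge_inf; last by exists f.
    exists (- p (- x)) => _ [[g [sg gp]] _ <-] /=.
    by apply: le_trans (sublinear_geN x sg); rewrite lerN2.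
  have q_ge x c : (forall f : T, F f -> c <= sval f x) -> c <= q x.
    move=> h; apply: lb_le_inf; first by exists (sval f0 x), f0.
    by move=> _ [f /h h' <-].
  have sq : sublinear q.
    apply: sublinearW => [x y||r x r0].
    + rewrite -lerBlDl; apply: (q_ge) => f Ff; rewrite lerBlDr -lerBlDl.
      apply: (q_ge) => g Fg; rewrite lerBlDl.
      have [/asboolP gf|/asboolP fg] := totF _ _ Ff Fg.
        have := q_le g (x + y) Fg; have := (proj2_sig g).1.1 x y.
        by have := gf y; lra.
      have := q_le f (x + y) Ff; have := (proj2_sig f).1.1 x y.
      by have := fg x; lra.
    + apply/eqP; rewrite eq_le; apply/andP; split.
        by rewrite (le_trans (q_le _ _ Ff0))// sublinear0//; exact: (proj2_sig f0).1.
      by apply: (q_ge) => f Ff; rewrite sublinear0//; exact: (proj2_sig f).1.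
    + rewrite -ler_pdivrMl//; apply: (q_ge) => f Ff; rewrite ler_pdivrMl//.
      by rewrite (le_trans (q_le f _ Ff))// (proj2_sig f).1.2// ltW.
  have qp x : q x <= p x := le_trans (q_le f0 x Ff0) ((proj2_sig f0).2 x).
  exists (exist _ q (conj sq qp)) => f Ff; apply/asboolP => x /=.
  exact: q_le.
- exists f; split=> // g sg gf.
  have gT : sublinear g /\ forall x, g x <= p x.
    by split=> // x; exact: le_trans (gf x) (fp x).
  by have /asboolP := fmin (exist _ g gT) (asboolT gf).
Qed.

(* Both the linearity of [f] and its value at [x0] come from comparing a minimal
   sublinear functional with its tilts. *)
Lemma hahn_banach p x0 : sublinear p ->
  exists f, [/\ {morph f : x y / x + y}, forall r x, f (r%:C *: x) = r * f x,
    forall x, f x <= p x & f x0 = p x0].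
Proof.
(* Minimality is used below the tilt of [p] along [x0], not just below [p]: this gives
   [f (- x0) <= - p x0]. *)
move=> sp; have [f [sf fp fmin]] := exists_minimal_sublinear (sublinear_tilt x0 sp).
have fN x : f (- x) = - f x.
  apply/eqP; rewrite eq_le; apply/andP; split; last first.
    by rewrite lerNl sublinear_geN.
  (* By minimality [f] lies below its own tilt along [x], which is evaluated at [- x] with parameter
     1. *)
  apply: (le_trans (fmin _ (sublinear_tilt x sf) (tilt_le_self _ sf) _)).
  apply: le_trans (tilt_le _ sf _ ler01) _.
  by rewrite scale1r addNr mul1r sublinear0// add0r.
exists f; split=> [x y|r x|x|].
- have := sf.1 (x + y) (- y); have := sf.1 x y; rewrite addrK fN => h1 h2.
  by apply/eqP; rewrite eq_le h1/=; lra.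
- have [r0|/ltW r0] := leP 0 r; first exact: sf.2.
  by rewrite -[r]opprK rmorphN/= scaleNr fN sf.2 ?oppr_ge0// !mulNr.
- exact: le_trans (fp x) (tilt_le_self _ sp x).
- apply/eqP; rewrite eq_le (le_trans (fp _) (tilt_le_self _ sp _))//=.
  rewrite -lerN2 -fN (le_trans (fp _))// (le_trans (tilt_le _ sp _ ler01))//.
  by rewrite scale1r addNr mul1r sublinear0// add0r.
Qed.

End sublinear_functionals.

(** * Norming functionals *)

Section rnorm.
Context {R : realType} {V : normedModType (C R)}.
Implicit Types x y : V.

Lemma rnormN x : rnorm (- x) = rnorm x.
Proof. by rewrite /rnorm normrN. Qed.

Lemma rdistC x y : rnorm (x - y) = rnorm (y - x).
Proof. by rewrite -rnormN opprB. Qed.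

Lemma rdist_triangle z x y : rnorm (x - y) <= rnorm (x - z) + rnorm (z - y).
Proof. by apply: le_trans (rnormD _ _); rewrite addrA subrK. Qed.

Lemma rnorm_sum (I : Type) (r : seq I) (P : pred I) (F : I -> V) :
  rnorm (\sum_(i <- r | P i) F i) <= \sum_(i <- r | P i) rnorm (F i).
Proof.
elim/big_rec2: _ => [|i y z _ yz]; first by rewrite rnorm0.
by rewrite (le_trans (rnormD _ _))// lerD2l.
Qed.

Lemma complex_gt0 (e : C R) : 0 < e -> exists2 r : R, 0 < r & e = r%:C.
Proof.
move=> e0; exists (complex.Re e); last by rewrite RRe_real// gtr0_real.
by move: e0; rewrite ltcE => /andP[].
Qed.

Lemma ball_rnorm x (r : R) : ball x r%:C = [set y | rnorm (x - y) < r].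
Proof. by rewrite -ball_normE; apply/seteqP; split=> y /=; rewrite -rnormE ltcR. Qed.

Lemma cvg_rnormP (u : nat -> V) x : u @ \oo --> x <->
  forall e : R, 0 < e -> \forall n \near \oo, rnorm (x - u n) < e.
Proof.
split=> [/cvgrPdist_lt ux e e0|ux].
  have := ux e%:C; rewrite ltcR => /(_ e0); apply: filterS => n /=.
  by rewrite -rnormE ltcR.
apply/cvgrPdist_lt => _ /complex_gt0[e e0 ->]; apply: filterS (ux _ e0) => n /=.
by rewrite -rnormE ltcR.
Qed.

Lemma cvg_rnorm_le (u : nat -> V) x (M : R) :
  u @ \oo --> x -> (forall n, rnorm (u n) <= M) -> rnorm x <= M.
Proof.
move=> /cvg_rnormP ux uM; apply/ler_addgt0Pr => e /ux[n _ /(_ n (leqnn n))/= xu].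
have := rnormD (x - u n) (u n); rewrite subrK; have := uM n; lra.
Qed.

End rnorm.

Section complex_scalars.
Context {R : realType}.
Implicit Types z w : C R.

Lemma rnormM z w : rnorm (z * w) = rnorm z * rnorm w.
Proof. exact: (@rnormZ R (C R) z w). Qed.

Lemma rnorm_real (r : R) : rnorm (r%:C : C R) = `|r|.
Proof. by rewrite /rnorm normc_def /= expr0n addr0 sqrtr_sqr. Qed.

Lemma rnorm1 : rnorm (1 : C R) = 1.
Proof. by rewrite (rnorm_real 1) normr1. Qed.

Lemma Re_le_rnorm z : `|complex.Re z| <= rnorm z.
Proof. by rewrite /rnorm normc_def /= -sqrtr_sqr ler_sqrt ?lerDl ?addr_ge0 ?sqr_ge0. Qed.

Lemma Im_le_rnorm z : `|complex.Im z| <= rnorm z.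
Proof. by rewrite /rnorm normc_def /= -sqrtr_sqr ler_sqrt ?lerDr ?addr_ge0 ?sqr_ge0. Qed.

Lemma rnorm_le_Re_Im z : rnorm z <= `|complex.Re z| + `|complex.Im z|.
Proof.
rewrite /rnorm normc_def /= -[leRHS]ger0_norm ?addr_ge0// -sqrtr_sqr.
rewrite ler_sqrt ?sqr_ge0// sqrrD !real_normK ?num_real//.
by rewrite addrAC lerDl mulrn_wge0// mulr_ge0.
Qed.

Lemma phase z : exists2 u : C R, rnorm u <= 1 & u * z = (rnorm z)%:C.
Proof.
have [->|z0] := eqVneq z 0.
  by exists 0; rewrite ?mulr0 ?rnorm0.
exists ((rnorm z)%:C * z^-1); last by rewrite mulfVK.
have : rnorm z * rnorm z^-1 = 1 by rewrite -rnormM mulfV// rnorm1.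
by rewrite rnormM rnorm_real ger0_norm ?rnorm_ge0// => ->.
Qed.

(** A real-linear [f] below the norm, equal to it at [x0], is complexified as $f(x) - i f(ix)$. The
    modulus is controlled by rotation: if [u] is a phase of [phi x], then $|\phi(x)| = f(ux) \le
    \|x\|$. *)
Lemma exists_norming (A : normedModType (C R)) (x0 : A) :
  exists2 phi : {linear A -> C R}, (forall x, rnorm (phi x) <= rnorm x) &
    rnorm (phi x0) = rnorm x0.
Proof.
have sn : sublinear (@rnorm R A).
  split=> [x y|r x r0]; first exact: rnormD.
  by rewrite rnormZ rnorm_real ger0_norm.
have [f [fD fZ f_le fx0]] := hahn_banach x0 sn.
pose phi x : C R := f x +i* - f ('i *: x).
have phi_lin : linear phi.
  move=> [a b] x y; rewrite /phi scalerDr !fD.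
  have -> : a +i* b = a%:C + b%:C * 'i by simpc.
  rewrite scalerDl -scalerA fD !fZ scalerDr fD !scalerA.
  have -> : 'i * a%:C = a%:C * 'i :> C R by rewrite mulrC.
  have -> : 'i * (b%:C * 'i) = (- b)%:C :> C R by simpc.
  rewrite -!scalerA !fZ /GRing.scale /=; simpc; congr (_ +i* _); lra.
pose phiL : {linear A -> C R} :=
  HB.pack phi (GRing.isLinear.Build _ _ _ _ phi phi_lin).
have phi_le x : rnorm (phiL x) <= rnorm x.
  have [u u1 uphi] := phase (phiL x).
  rewrite -[leLHS]/(complex.Re (rnorm (phiL x))%:C) -uphi.
  have -> : u * phiL x = phiL (u *: x) by rewrite linearZ.
  rewrite (le_trans (f_le _))// rnormZ.
  by rewrite -[leRHS]mul1r ler_wpM2r ?rnorm_ge0.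
exists phiL => //; apply/eqP; rewrite eq_le phi_le andTb -fx0.
exact: le_trans (ler_norm (f x0)) (Re_le_rnorm (phiL x0)).
Qed.

End complex_scalars.

(** * Operator norms and the dual unit ball *)

Section operator_norm.
Context {R : realType} {V W : normedModType (C R)}.

Section homogeneous.
Variable f : V -> W.
Hypothesis fZ : scalable f.

Lemma opnorm_le (M : R) : 0 <= M -> (forall x, rnorm (f x) <= M * rnorm x) ->
  opnorm f <= M.
Proof.
move=> M0 fM; apply: ge_sup; first by exists (rnorm (f 0)), 0 => //=; rewrite rnorm0.
by move=> _ [x /= x1 <-]; rewrite (le_trans (fM x))// ler_piMr.
Qed.

(** The bound by [M] makes [opnorm f] a genuine supremum; a nonzero [x] is then normalized. *)
Lemma le_opnorm (M : R) x : (forall x, rnorm (f x) <= M * rnorm x) ->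
  rnorm (f x) <= opnorm f * rnorm x.
Proof.
move=> fM; have [->|x0] := eqVneq x 0.
  by rewrite -[0 in leLHS](scale0r (0 : V)) fZ scale0r !rnorm0 mulr0.
have nx : 0 < rnorm x.
  by rewrite lt_def rnorm_ge0 andbT; apply: contra_neq x0; exact: rnorm0_eq0.
have nV : rnorm ((rnorm x)^-1%:C : C R) = (rnorm x)^-1.
  by rewrite rnorm_real ger0_norm// invr_ge0 ltW.
rewrite -ler_pdivrMr// mulrC -nV -rnormZ -fZ; apply: ub_le_sup.
  exists `|M| => _ [y /= y1 <-]; rewrite (le_trans (fM y))//.
  rewrite (le_trans (ler_norm _))// normrM [ `|rnorm y|]ger0_norm ?rnorm_ge0//.
  by rewrite ler_piMr.
by eexists; last reflexivity; rewrite /= rnormZ nV mulVf// gt_eqF.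
Qed.

End homogeneous.

Lemma continuous_linear_rnorm (f : {linear V -> W}) :
  continuous f <-> exists M : R, forall x, rnorm (f x) <= M * rnorm x.
Proof.
rewrite -linear_bounded_continuous linear_boundedP; split.
  move=> /pinfty_ex_gt0[_ /complex_gt0[M M0 ->]] fM; exists M => x.
  by rewrite -lecR rmorphM/= !rnormE.
move=> [M fM]; exists `|M|%:C; split; first by rewrite ger0_real// lecR.
move=> k Mk x; rewrite (@le_trans _ _ (`|M|%:C * `|x|))//; last by rewrite ler_wpM2r// ltW.
rewrite -[ `|f x|]rnormE -[ `|x|]rnormE -rmorphM/= lecR (le_trans (fM x))//.
by rewrite ler_wpM2r ?rnorm_ge0// ler_norm.
Qed.

End operator_norm.

(** For an unbounded functional the supremum [opnorm phi] is 0 by convention; continuity excludes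
    this case. *)
Lemma dual_ballP (R : realType) (A : normedModType (C R)) (phi : {linear A -> C R}) :
  dual_ball phi <-> forall x, rnorm (phi x) <= rnorm x.
Proof.
split=> [[/continuous_linear_rnorm[M phiM] phi1] x|phi_le].
  have phiZ : scalable phi by move=> k y; rewrite linearZ.
  have := le_opnorm phiZ x phiM.
  by move=> /le_trans; apply; rewrite -[leRHS]mul1r ler_wpM2r ?rnorm_ge0.
have phi1 x : rnorm (phi x) <= 1 * rnorm x by rewrite mul1r.
by split; [apply/continuous_linear_rnorm; exists 1|exact: opnorm_le].
Qed.

(** * Finite nets and total boundedness *)

Section nets.
Context {R : realType}.

(** The net lies in [X] itself, and [E] is any relation, so that closeness can mean uniform
    closeness of pairings. *)
Definition has_nets (T : Type) (X : set T) (E : R -> T -> T -> Prop) :=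
  forall e, 0 < e -> exists n (t : 'I_n -> T),
    (forall i, X (t i)) /\ forall x, X x -> exists i, E e x (t i).

(** One representative in [X] is chosen for each [j] whose class meets [X]; the classes may
    overlap. *)
Lemma net_of_finite_cover (T : Type) (X : set T) (J : finType) (P : J -> T -> Prop) :
  (forall x, X x -> exists j, P j x) -> exists n (t : 'I_n -> T),
    (forall i, X (t i)) /\ forall x, X x -> exists i j, P j x /\ P j (t i).
Proof.
move=> XP; pose S := [set j : J | `[< exists x, X x /\ P j x >]]%SET.
have /choice[t tP] (i : 'I_#|S|) : exists x, X x /\ P (enum_val i) x.
  by have := enum_valP i; rewrite inE => /asboolP.
exists #|S|, t; split=> [i|x Xx]; first exact: (tP i).1.
have [j Pjx] := XP x Xx.
have jS : j \in S by rewrite inE; apply/asboolP; exists x.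
exists (enum_rank_in jS j), j; split=> //.
by have := (tP (enum_rank_in jS j)).2; rewrite enum_rankK_in.
Qed.

Lemma has_netsW (T : Type) (X : set T) (E E' : R -> T -> T -> Prop) :
  (forall e x y, 0 < e -> X x -> X y -> E e x y -> E' e x y) ->
  has_nets X E -> has_nets X E'.
Proof.
move=> EE' nE e e0; have [n [t [Xt tE]]] := nE e e0.
exists n, t; split=> // x Xx; have [i Exi] := tE x Xx; exists i; exact: EE'.
Qed.

Lemma totally_bounded_nets (T : Type) (V : normedModType (C R)) (X : set T) (g : T -> V) :
  totally_bounded (g @` X) <-> has_nets X (fun e x y => rnorm (g x - g y) <= e).
Proof.
split=> [tb e e0|nX _ /complex_gt0[e e0 ->]].
  (* Centres may lie outside the image; replacing one by a point of the image in its ball doubles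
     the radius. *)
  have e20 : 0 < (e / 2)%:C by rewrite ltcR divr_gt0.
  have [F /finite_seqP[s ->] XF] := tb _ e20.
  pose P (i : 'I_(size s)) x := ball (nth 0 s i) (e / 2)%:C (g x).
  have [x Xx|n [t [Xt tP]]] := @net_of_finite_cover _ X _ P.
    have [|y /= ys yx] := XF (g x); first by exists x.
    have ys' : (index y s < size s)%N by rewrite index_mem.
    by exists (Ordinal ys'); rewrite /P/= nth_index.
  exists n, t; split=> // x /tP[i [j []]]; rewrite /P !ball_rnorm/= => jx ji.
  exists i; have := rdist_triangle (nth 0 s j) (g x) (g (t i)).
  rewrite [rnorm (g x - nth 0 s j)]rdistC; lra.
(* Halving turns the non-strict bound of a net into the strict one of a ball. *)
have e20 : 0 < e / 2 by rewrite divr_gt0.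
have [n [t [Xt tX]]] := nX _ e20.
exists (range (g \o t)); first exact/finite_image/finite_finset.
move=> _ [x /tX[i xi] <-]; exists (g (t i)); first by exists i.
rewrite ball_rnorm/= rdistC; lra.
Qed.

Lemma real_colouring (M d : R) : 0 < d ->
  exists n (c : R -> 'I_n), forall a b, `|a| <= M -> `|b| <= M -> c a = c b ->
    `|a - b| <= d.
Proof.
move=> d0; pose n := Num.truncn (2 * M / d).
(* [k a] numbers the interval of length [d] containing [a], counted from [- M]. The indices run from
   0 to [n] included, since [a = M] has index [n]. *)
pose k a := Num.truncn ((a + M) / d).
exists n.+1, (fun a => inord (k a)).
have kn a : `|a| <= M -> (k a < n.+1)%N.
  rewrite ler_norml => /andP[aM aM']; rewrite ltnS le_truncn//.
  by rewrite ler_pM2r ?invr_gt0//; lra.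
have k_itv a : `|a| <= M -> (k a)%:R * d <= a + M < (k a).+1%:R * d.
  rewrite ler_norml => /andP[aM aM'].
  have /truncn_itv/andP[k1 k2] : 0 <= (a + M) / d by apply: divr_ge0; lra.
  by rewrite -ler_pdivlMr// -ltr_pdivrMr// k1 k2.
move=> a b aM bM /(congr1 val); rewrite /= !inordK ?kn// => kab.
have := k_itv a aM; have := k_itv b bM; rewrite kab -natr1 mulrDl mul1r.
by rewrite ler_norml => /andP[? ?] /andP[? ?]; apply/andP; split; lra.
Qed.

Lemma complex_colouring (M d : R) : 0 < d ->
  exists (J : finType) (c : C R -> J), forall z w, rnorm z <= M -> rnorm w <= M ->
    c z = c w -> rnorm (z - w) <= d.
Proof.
move=> d0; have d20 : 0 < d / 2 by rewrite divr_gt0.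
have [n [c cP]] := real_colouring M d20.
exists ('I_n * 'I_n)%type, (fun z => (c (complex.Re z), c (complex.Im z))).
move=> z w zM wM [zw1 zw2]; apply: le_trans (rnorm_le_Re_Im _) _.
have := cP _ _ (le_trans (Re_le_rnorm z) zM) (le_trans (Re_le_rnorm w) wM) zw1.
have := cP _ _ (le_trans (Im_le_rnorm z) zM) (le_trans (Im_le_rnorm w) wM) zw2.
rewrite raddfB/= raddfB/=; lra.
Qed.

(* Abstract form of Schauder's theorem: points of [X] whose pairings with a
   finite net of [Y] have the same colours are close uniformly over [Y]. *)
Lemma has_nets_dual (T U : Type) (X : set T) (Y : set U) (f : T -> U -> C R) (M : R) :
  (forall x y, X x -> Y y -> rnorm (f x y) <= M) ->
  has_nets Y (fun e y y' => forall x, X x -> rnorm (f x y - f x y') <= e) ->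
  has_nets X (fun e x x' => forall y, Y y -> rnorm (f x y - f x' y) <= e).
Proof.
(* The three thirds pay for moving [y] to a net point, exchanging [x] for a point with the same
   colours, and moving back to [y]. *)
move=> fM nY e e0; have e30 : 0 < e / 3 by rewrite divr_gt0.
have [n [t [Yt tY]]] := nY _ e30.
have [J [c cP]] := complex_colouring M e30.
pose P (j : {ffun 'I_n -> J}) x := j = [ffun i => c (f x (t i))].
have [x Xx|m [s [Xs sP]]] := @net_of_finite_cover _ X _ P; first by eexists.
exists m, s; split=> // x Xx; have [i [j [jx ji]]] := sP x Xx.
exists i => y Yy; have [k yk] := tY y Yy.
have cE : c (f x (t k)) = c (f (s i) (t k)).
  by move/ffunP: jx; rewrite ji => /(_ k); rewrite !ffunE.
have := cP _ _ (fM _ _ Xx (Yt k)) (fM _ _ (Xs i) (Yt k)) cE.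
have := yk x Xx; have := yk (s i) (Xs i); rewrite [rnorm (f (s i) y - _)]rdistC.
have := rdist_triangle (f x (t k)) (f x y) (f (s i) y).
have := rdist_triangle (f (s i) (t k)) (f x (t k)) (f (s i) y).
lra.
Qed.

End nets.

(** Forward, finitely many balls cover the compact closure. Backward, an ultrafilter on the closure
    contains balls of every radius, hence is Cauchy and converges by completeness. *)
Lemma precompact_totally_bounded (R : realType) (V : completeNormedModType (C R))
  (S : set V) : precompact S <-> totally_bounded S.
Proof.
rewrite precompactE; split=> [cS e e0|tb].
  move: cS; rewrite compact_cover => /(_ V setT (fun y => ball y e)).
  case=> [y _|y _|F _ SF]; first exact: ball_open.
    by exists y => //; exact: ballxx.
  exists [set` F]; first exact: finite_fset.
  by move=> x Sx; apply: SF; exact: subset_closure.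
rewrite compact_ultra => F UF FS.
have /cauchy_exP/cauchy_cvg/cvg_ex[p Fp] : cauchy_ex F.
  move=> _ /complex_gt0[e e0 ->]; apply: contrapT => Fball.
  (* One half goes from a point of the closure to a point of [S], the other from there to a
     centre. *)
  have e20 : 0 < (e / 2)%:C by rewrite ltcR divr_gt0.
  have [G /finite_fsetP[D ->] SD] := tb _ e20.
  have FD : F (\bigcap_(y in [set` D]) ~` ball y e%:C).
    apply: filter_bigI => y _.
    have [Fy|//] := in_ultra_setVsetC (ball y e%:C) UF.
    by case: Fball; exists y.
  have [x [clSx xD]] := filter_ex (filterI FS FD).
  have [y [Sy xy]] := clSx _ (nbhsx_ballx x _ e20).
  have [z zD zy] := SD y Sy; apply: (xD z zD).
  move: xy zy; rewrite !ball_rnorm/= => xy zy.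
  have := rdist_triangle y z x; rewrite [rnorm (y - x)]rdistC; lra.
exists p; split=> //; apply: closed_closure => B pB.
exact: filter_ex (filterI FS (Fp _ pB)).
Qed.

(** * Weakly summable sequences *)

Section l1_partial_sums.
Context {R : realType}.
Implicit Types (x : nat -> C R) (M : R).

Lemma l1_partial_sum_le (x : l1 R) n : \sum_(0 <= i < n) rnorm (x i) <= rnorm x.
Proof.
rewrite rnorm_l1; apply: (@nondecreasing_cvgn_le R (series (fun i => rnorm (x i)))).
  by apply/nondecreasing_series => i _ _; exact: rnorm_ge0.
exact: l1_cvg.
Qed.

Lemma rnorm_l1_le (x : l1 R) M : (forall n, \sum_(0 <= i < n) rnorm (x i) <= M) ->
  rnorm x <= M.
Proof. by move=> xM; rewrite rnorm_l1; apply: limr_le; [exact: l1_cvg|exact: nearW]. Qed.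

Lemma in_l1_bounded x M : (forall n, \sum_(0 <= i < n) rnorm (x i) <= M) -> in_l1 x.
Proof.
move=> xM; apply/asboolP/nondecreasing_is_cvgn.
  by apply/nondecreasing_series => i _ _; exact: rnorm_ge0.
by exists M => _ [n _ <-]; exact: xM.
Qed.

End l1_partial_sums.

(** * Truncations in $c_0$ and functionals on $c_0$ *)

Section finite_sequences.
Context {R : realType}.
Implicit Types (b : nat -> C R) (n : nat).

Lemma unit_seq_in_c0 n : in_c0 (fun i => (i == n)%:R : C R).
Proof.
apply/asboolP; apply: cvg_near_cst; exists n.+1 => // i /= ni.
by rewrite gtn_eqF.
Qed.

Definition unit_seq n : c0 R := C0 (unit_seq_in_c0 n).

(** [b] need not tend to 0, so that sequences of phases can be truncated as well. *)
Definition trunc b n : c0 R := \sum_(0 <= i < n) b i *: unit_seq i.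

Lemma truncE b n i : trunc b n i = if (i < n)%N then b i else 0.
Proof.
elim: n => [|n IH]; first by rewrite /trunc big_geq.
rewrite /trunc big_nat_recr//= -/(trunc b n).
rewrite -[LHS]/(trunc b n i + b n * (i == n)%:R) IH ltnS.
by case: (ssrnat.ltngtP i n) => [_|_|->] /=; rewrite ?mulr0n ?mulr1n ?mulr0 ?mulr1 ?addr0 ?add0r.
Qed.

Lemma trunc_norm_le b n (M : R) : 0 <= M -> (forall i, rnorm (b i) <= M) ->
  rnorm (trunc b n) <= M.
Proof.
move=> M0 bM; apply: c0_rnorm_le => i; rewrite truncE.
by case: ifP => // _; rewrite rnorm0.
Qed.

Lemma trunc_cvg (b : c0 R) : trunc b @ \oo --> b.
Proof.
apply/cvg_rnormP => e e0; have e20 : 0 < e / 2 by rewrite divr_gt0.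
have : c0_seq b @ \oo --> (0 : C R) by case: b => b /= /asboolP.
move=> /cvg_rnormP/(_ _ e20)[N _ bN]; exists N => // n /= Nn.
apply: (@le_lt_trans _ _ (e / 2)); last by lra.
apply: c0_rnorm_le => i; rewrite -[X in rnorm X]/(b i - trunc b n i) truncE.
have [ni|ni] := ltnP i n; first by rewrite subrr rnorm0 ltW.
by have := bN i (leq_trans Nn ni); rewrite /= add0r rnormN subr0 => /ltW.
Qed.

(* Test [F] on the truncated sequence of phases of [F (unit_seq i)]. *)
Lemma c0_dual_sum_le (F : c0 R -> C R) (M : R) : linear F ->
  (forall b : c0 R, rnorm b <= 1 -> rnorm (F b) <= M) ->
  forall n, \sum_(0 <= i < n) rnorm (F (unit_seq i)) <= M.
Proof.
move=> linF FM n.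
pose FL : {linear c0 R -> C R} := HB.pack F (GRing.isLinear.Build _ _ _ _ F linF).
have /choice[u uP] (i : nat) : exists u : C R, rnorm u <= 1 /\
    u * F (unit_seq i) = (rnorm (F (unit_seq i)))%:C.
  by have [u] := phase (F (unit_seq i)); exists u.
have Fu : F (trunc u n) = (\sum_(0 <= i < n) rnorm (F (unit_seq i)))%:C.
  rewrite -[LHS]/(FL (trunc u n)) linear_sum rmorph_sum.
  by apply: eq_bigr => i _; rewrite linearZ; exact: (uP i).2.
have := FM _ (trunc_norm_le n ler01 (fun i => (uP i).1)).
by rewrite Fu rnorm_real => /(le_trans (ler_norm _)).
Qed.

End finite_sequences.

Section weakly_summable.
Context {R : realType} {A : normedModType (C R)}.
Variables (a : nat -> A).

(** For [a] in [l1b], the least such [M] is [norm1 a]. Finite sums avoid both limits and the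
    convention on unbounded suprema. *)
Definition weakly_bounded (M : R) := forall phi : {linear A -> C R}, dual_ball phi ->
  forall n, \sum_(0 <= i < n) rnorm (phi (a i)) <= M.

Lemma weakly_bounded_ge0 M : weakly_bounded M -> 0 <= M.
Proof.
have [phi /dual_ballP phi1 _] := exists_norming (0 : A).
by move=> /(_ phi phi1 0%N); rewrite big_geq.
Qed.

Lemma weakly_bounded_in_l1 M phi : weakly_bounded M -> dual_ball phi ->
  in_l1 (phi \o a).
Proof. by move=> aM /aM; exact: in_l1_bounded. Qed.

Lemma l1b_weakly_bounded : l1b a -> weakly_bounded (norm1 a).
Proof.
move=> [aw /pinfty_ex_gt0[_ /complex_gt0[M M0 ->] aM]] phi phi1 n.
pose x := L1 (aw phi phi1).
have xa : weak_image a x by exists phi.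
apply: (le_trans (l1_partial_sum_le x n)); apply: ub_le_sup; last by exists x.
by exists M => _ [y /aM /= yM <-]; rewrite -lecR rnormE.
Qed.

Lemma weakly_bounded_weak_image M x : weakly_bounded M -> weak_image a x ->
  rnorm x <= M.
Proof.
move=> aM [phi phi1 xE]; apply: rnorm_l1_le => n; rewrite xE.
exact: aM.
Qed.

Lemma weakly_bounded_l1b M : weakly_bounded M -> l1b a.
Proof.
move=> aM; split=> [phi|]; first exact: weakly_bounded_in_l1 aM.
exists M%:C; split=> [|k Mk x /(weakly_bounded_weak_image aM) xM].
  by apply/complex_realP; exists M.
by apply: le_trans (ltW Mk); rewrite -rnormE lecR.
Qed.

Lemma norm1_le M : weakly_bounded M -> norm1 a <= M.
Proof.
move=> aM; apply: ge_sup; last by move=> _ [x /(weakly_bounded_weak_image aM) ? <-].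
have [phi /dual_ballP phi1 _] := exists_norming (0 : A).
pose x := L1 (weakly_bounded_in_l1 aM phi1).
by exists (rnorm x), x => //; exists phi.
Qed.

(** A norming functional of the block reduces the estimate to scalars. Small [s] gives the Cauchy
    criterion, and [m = 0] the norm bound. *)
Lemma block_norm_le M (b : nat -> C R) m n (s : R) : weakly_bounded M -> 0 <= s ->
  (forall i, (m <= i)%N -> rnorm (b i) <= s) ->
  rnorm (\sum_(m <= i < n) b i *: a i) <= s * M.
Proof.
move=> aM s0 bs.
have [mn|nm] := leqP m n; last first.
  by rewrite big_geq ?(ltnW nm)// rnorm0 mulr_ge0// (weakly_bounded_ge0 aM).
have [phi phi1 <-] := exists_norming (\sum_(m <= i < n) b i *: a i).
rewrite linear_sum (le_trans (rnorm_sum _ _ _))//.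
apply: (@le_trans _ _ (s * \sum_(m <= i < n) rnorm (phi (a i)))).
  rewrite mulr_sumr; apply: ler_sum_nat => i /andP[mi _].
  by rewrite linearZ/= rnormM ler_wpM2r ?rnorm_ge0// bs.
rewrite ler_wpM2l// (le_trans _ (aM phi _ n)) ?dual_ballP//.
rewrite [leRHS](big_cat_nat (leq0n m) mn)/= lerDr sumr_ge0// => i _.
exact: rnorm_ge0.
Qed.


End weakly_summable.

(** * The operator induced by a sequence *)

Lemma Lambda_unit_seq (R : realType) (A : normedModType (C R)) (a : nat -> A) n :
  Lambda a (unit_seq n) = a n.
Proof.
apply: cvg_lim; first exact: norm_hausdorff.
apply: cvg_near_cst; exists n.+1 => // m /= nm.
rewrite /Lambda_series /series/= (bigD1_seq n) ?iota_uniq ?mem_index_iota//=.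
by rewrite eqxx scale1r big1 ?addr0// => i /negPf ->; rewrite scale0r.
Qed.

Section Lambda_operator.
Context {R : realType} {A : completeNormedModType (C R)}.
Variables (a : nat -> A) (M : R).
Hypothesis aM : weakly_bounded a M.

Lemma cvg_Lambda_series (b : c0 R) : cvgn (Lambda_series a b).
Proof.
apply/cauchy_cvgP/cauchy_seriesP => _ /complex_gt0[e e0 ->].
have M0 := weakly_bounded_ge0 aM.
(* [M] may be 0, hence the division by [M + 1]. *)
have M1 : 0 < M + 1 by lra.
have d0 : 0 < e / (M + 1) by rewrite divr_gt0.
have : c0_seq b @ \oo --> (0 : C R) by case: b => b /= /asboolP.
move=> /cvg_rnormP/(_ _ d0)[N _ bN].
(* Only [m] has to be large: for [n <= m] the block is empty. *)
exists ([set n | (N <= n)%N], setT) => /=; first by split; [exists N|exact: filterT].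
move=> [m n] /= [Nm _]; rewrite -rnormE ltcR.
have bm i : (m <= i)%N -> rnorm (b i) <= e / (M + 1).
  by move=> mi; have := bN i (leq_trans Nm mi); rewrite /= add0r rnormN => /ltW.
apply: (le_lt_trans (block_norm_le n aM (ltW d0) bm)).
by rewrite mulrAC ltr_pdivrMr// ltr_pM2l//; lra.
Qed.

Lemma rnorm_Lambda_le (b : c0 R) : rnorm (Lambda a b) <= M * rnorm b.
Proof.
apply: (cvg_rnorm_le (cvg_Lambda_series (b := b))) => n; rewrite mulrC.
apply: (block_norm_le n aM (rnorm_ge0 b)) => i _; exact: c0_rnorm_ub.
Qed.

Lemma linear_Lambda : linear (Lambda a).
Proof.
move=> k b b'.
apply: cvg_lim; first exact: norm_hausdorff.
have -> : Lambda_series a (k *: b + b') =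
    (fun n => k *: Lambda_series a b n + Lambda_series a b' n).
  apply/funext => n; rewrite scaler_sumr -big_split; apply: eq_bigr => i _ /=.
  by rewrite -[LHS]/((k * b i + b' i) *: a i) scalerDl -scalerA.
apply: cvgD; last exact: cvg_Lambda_series.
by apply: cvgZ; [exact: cvg_cst|exact: cvg_Lambda_series].
Qed.

Lemma bounded_linear_Lambda : bounded_linear (Lambda a).
Proof. by split; [exact: linear_Lambda|exists M => b; exact: rnorm_Lambda_le]. Qed.

(** [chi] ranges beyond the dual ball because it will be a difference of two of its members. *)
Lemma dual_Lambda_le (chi : {linear A -> C R}) (N : R) (b : c0 R) :
  continuous chi -> (forall n, \sum_(0 <= i < n) rnorm (chi (a i)) <= N) ->
  rnorm (chi (Lambda a b)) <= rnorm b * N.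
Proof.
move=> chi_cont chiN.
have chib : chi \o Lambda_series a b @ \oo --> chi (Lambda a b).
  by apply: continuous_cvg; [exact: chi_cont|exact: cvg_Lambda_series].
apply: (cvg_rnorm_le chib) => n /=.
rewrite linear_sum (le_trans (rnorm_sum _ _ _))//.
apply: (@le_trans _ _ (rnorm b * \sum_(0 <= i < n) rnorm (chi (a i)))).
  rewrite mulr_sumr; apply: ler_sum => i _.
  by rewrite linearZ/= rnormM ler_wpM2r ?rnorm_ge0//; exact: c0_rnorm_ub.
by rewrite ler_wpM2l ?rnorm_ge0.
Qed.

(** The phase argument on $c_0$, applied to [chi \o Lambda a]. With [dual_Lambda_le] it identifies,
    for continuous [chi], the norm of this functional with $\|\chi(\mathbf a)\|_1$. *)
Lemma dual_Lambda_sum_le (chi : {linear A -> C R}) (N : R) :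
  (forall b : c0 R, rnorm b <= 1 -> rnorm (chi (Lambda a b)) <= N) ->
  forall n, \sum_(0 <= i < n) rnorm (chi (a i)) <= N.
Proof.
move=> chiN n.
have lin : linear (chi \o Lambda a).
  by move=> k x y /=; rewrite linear_Lambda linearP.
have := c0_dual_sum_le lin chiN n.
by under eq_bigr do rewrite /= Lambda_unit_seq.
Qed.

Lemma weakly_bounded_opnorm : weakly_bounded a (opnorm (Lambda a)).
Proof.
move=> phi /dual_ballP phi1; apply: dual_Lambda_sum_le => b b1.
have LZ : scalable (Lambda a).
  move=> k x; have := linear_Lambda k x 0; rewrite !addr0.
  have := linear_Lambda 1 0 0; rewrite !scale1r addr0 -{1}[Lambda a 0]addr0.
  by move=> /addrI <-; rewrite addr0.
apply: (le_trans (phi1 _)); apply: (le_trans (le_opnorm LZ b rnorm_Lambda_le)).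
(* [opnorm (Lambda a)] is nonnegative, being the supremum of a bounded set that contains the norm of
   the value at 0. *)
rewrite ler_piMr//; apply: le_trans (rnorm_ge0 (Lambda a 0)) _.
apply: ub_le_sup; last by exists 0; rewrite /= ?rnorm0.
exists M => _ [x /= x1 <-]; rewrite (le_trans (rnorm_Lambda_le _))//.
by rewrite ler_piMr// (weakly_bounded_ge0 aM).
Qed.

(** Distances in [A] and in $\ell^1$ are uniform distances of pairings: [XE] comes from norming
    functionals, [YE] from phases. Then [has_nets_dual] transfers nets either way. *)
Lemma compact_Lambda : compact_op (Lambda a) <-> totally_bounded (weak_image a).
Proof.
pose X : set (c0 R) := [set b | rnorm b <= 1].
pose Y : set {linear A -> C R} := @dual_ball R A.
pose f (b : c0 R) (phi : {linear A -> C R}) : C R := phi (Lambda a b).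
have fM b phi : X b -> Y phi -> rnorm (f b phi) <= M.
  move=> b1 /dual_ballP phi1; apply: (le_trans (phi1 _)).
  rewrite (le_trans (rnorm_Lambda_le _))// ler_piMr//.
  exact: weakly_bounded_ge0 aM.
(* The default 0 can occur only off the dual ball. *)
pose g (phi : {linear A -> C R}) : l1 R := insubd 0 (phi \o a).
have gE phi : Y phi -> g phi = phi \o a :> (nat -> C R).
  by move=> /(weakly_bounded_in_l1 aM) phia; exact: insubdK.
have -> : weak_image a = g @` Y.
  apply/seteqP; split=> [x [phi phi1 xE]|_ [phi phi1 <-]].
    by exists phi => //; apply: val_inj; rewrite [LHS]gE.
  by exists phi => //; exact: gE.
have XE e b b' : rnorm (Lambda a b - Lambda a b') <= e <->
    forall phi, Y phi -> rnorm (f b phi - f b' phi) <= e.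
  split=> [be phi /dual_ballP phi1|fe].
    by rewrite /f -linearB (le_trans (phi1 _)).
  have [phi /dual_ballP phi1 <-] := exists_norming (Lambda a b - Lambda a b').
  by rewrite linearB; exact: fe.
have YE e phi psi : 0 < e -> Y phi -> Y psi -> rnorm (g phi - g psi) <= e <->
    forall b, X b -> rnorm (f b phi - f b psi) <= e.
  move=> e0 phi1 psi1; pose chi : {linear A -> C R} := phi \- psi.
  have gchi i : (g phi - g psi) i = chi (a i).
    by rewrite -[LHS]/(g phi i - g psi i) !gE.
  have chi_cont : continuous chi.
    by move=> x; apply: cvgB; [exact: phi1.1|exact: psi1.1].
  split=> [ge b b1|fe].
    have chie n : \sum_(0 <= i < n) rnorm (chi (a i)) <= e.
      apply: le_trans ge; apply: le_trans (l1_partial_sum_le _ n).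
      by under [leRHS]eq_bigr do rewrite gchi.
    apply: (le_trans (dual_Lambda_le b chi_cont chie)).
    by rewrite ler_piMl// ltW.
  apply: rnorm_l1_le => n; under eq_bigr do rewrite gchi.
  exact: dual_Lambda_sum_le.
rewrite /compact_op precompact_totally_bounded !totally_bounded_nets.
split=> nets.
(* Both closeness relations are restated through pairings, and the duality of nets is used with the
   arguments of [f] exchanged. *)
- apply: (@has_netsW _ _ _ (fun e phi psi =>
    forall b, X b -> rnorm (f b phi - f b psi) <= e)).
    by move=> e phi psi e0 phi1 psi1 /(YE _ _ _ e0 phi1 psi1).
  apply: (@has_nets_dual _ _ _ _ _ (fun phi b => f b phi) M) => [phi b ? ?|].
    exact: fM.
  by apply: has_netsW nets => e b b' _ _ _ /XE.
- apply: (@has_netsW _ _ _ (fun e b b' =>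
    forall phi, Y phi -> rnorm (f b phi - f b' phi) <= e)).
    by move=> e b b' _ _ _ /XE.
  apply: (has_nets_dual fM).
  by apply: has_netsW nets => e phi psi e0 phi1 psi1 /(YE _ _ _ e0 phi1 psi1).
Qed.

End Lambda_operator.

(** The partial sums of the series are the images under [L] of the truncations of [b], which
    converge to [b]. Phases bound the sums of $|\phi(a_i)|$. *)
Lemma bounded_linear_c0 (R : realType) (A : normedModType (C R)) (L : c0 R -> A) :
  bounded_linear L -> exists2 a, l1b a & L = Lambda a.
Proof.
move=> [linL [M LM]]; pose a i := L (unit_seq i).
pose LL : {linear c0 R -> A} := HB.pack L (GRing.isLinear.Build _ _ _ _ L linL).
have L_cont : continuous LL by apply/continuous_linear_rnorm; exists M.
exists a.
  apply: (@weakly_bounded_l1b _ _ _ `|M|) => phi /dual_ballP phi1.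
  apply: (@c0_dual_sum_le _ (phi \o L)) => [k x y|b b1] /=.
    by rewrite linL linearP.
  apply: (le_trans (phi1 _)); apply: (le_trans (LM _)).
  apply: (le_trans (ler_norm _)); rewrite normrM ler_piMr//.
  by rewrite ger0_norm ?rnorm_ge0.
apply/funext => b; apply/esym/cvg_lim; first exact: norm_hausdorff.
rewrite (_ : Lambda_series a b = LL \o trunc b).
  by apply: continuous_cvg; [exact: L_cont|exact: trunc_cvg].
apply/funext => n; rewrite -[RHS]/(LL (trunc b n)) linear_sum; apply: eq_bigr => i _.
by rewrite linearZ.
Qed.

Local Close Scope complex_scope.

Theorem theorem3p7 (R : realType) (A : completeNormedModType (C R)) :
  [/\ (forall a : nat -> A, l1b a ->
         [/\ forall b : c0 R, cvgn (Lambda_series a b),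
             bounded_linear (Lambda a)
           & opnorm (Lambda a) = norm1 a]),
      (forall L : c0 R -> A, bounded_linear L ->
         exists2 a : nat -> A, l1b a & L = Lambda a)
    & (forall a : nat -> A, l1b a ->
         (compact_op (Lambda a) <-> l1c a))].
Proof.
split=> [a /l1b_weakly_bounded aM|L|a ab].
- split; [exact: cvg_Lambda_series aM|exact: bounded_linear_Lambda aM|].
  (* Each side is an admissible bound for the other: [norm1 a] bounds the operator, and
     [opnorm (Lambda a)] bounds the sums of $|\phi(a_i)|$. *)
  apply/eqP; rewrite eq_le (norm1_le (weakly_bounded_opnorm aM)) andbT.
  by apply: opnorm_le (rnorm_Lambda_le aM); exact: weakly_bounded_ge0 aM.
- exact: bounded_linear_c0.
- rewrite (compact_Lambda (l1b_weakly_bounded ab)).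
  by split=> [tb|[]//]; split=> //; exact: ab.1.
Qed.
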